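(* Let $(\mathcal{A}^V,X,\Phi)$ be the symbolic dynamical system defined in the context, with $V=V_\Box\sqcup V_\circ$. The system $(X,\Phi)$ is posexpansive, with posexpansive window $\{\Box_0\}$.
   Context: Let $\mathcal{A}:=\mathbb{Z}/2\times\mathbb{Z}/2$. For $k\ge 0$ let $m_k:=\sum_{i=0}^k 2i=k(k+1)$ and $M:=\{m_k: k\ge 0\}=\{0,2,6,12,20,\dots\}$. The vertex set $V$ is indexed by $\mathbb{N}=\{0,1,2,\dots\}$: the vertex with index $n$ is denoted $\Box_n$ and belongs to $V_\Box$ if $n\in M$, and is denoted $\bigcirc_n$ and belongs to $V_\circ$ if $n\notin M$. The state of the vertex with index $n$ is a pair $(a_n,b_n)\in\mathbb{Z}/2\times\mathbb{Z}/2$. Let $X:=\{(a_n,b_n)_{n\in\mathbb{N}}\in\mathcal{A}^V : b_n=0\text{ for all } n\notin M\}$. The map $\Phi:\mathcal{A}^V\to\mathcal{A}^V$ is defined as follows, where $(a'_n,b'_n)_n=\Phi((a_n,b_n)_n)$: - for $n\notin M$: $(a'_n,b'_n)=(a_{n+1},0)$; - for $n=m_k\in M$: $(a'_{m_k},b'_{m_k})=(a_{m_k+1},\ a_{m_{k+1}}+b_{m_{k+1}})$. Then $\Phi$ is continuous and $\Phi(X)\subseteq X$. A finite set $W\subset V$ is a posexpansive window for $(X,\Phi)$ if the map $x\mapsto(x_W,\Phi(x)_W,\Phi^2(x)_W,\dots)$ is injective on $X$; $(X,\Phi)$ is posexpansive if it has a posexpansive window. *)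

(* Defs.v *)
From mathcomp Require Import all_boot all_algebra finmap.
From mathcomp Require Import boolp classical_sets functions topology.

Set Implicit Arguments.
Unset Strict Implicit.
Unset Printing Implicit Defensive.

Local Open Scope classical_set_scope.

Section Posexpansive.
Variables (V : choiceType) (A : Type).
Variables (X : set (V -> A)) (Phi : (V -> A) -> (V -> A)).

Definition restr (W : {fset V}) (x : V -> A) : W -> A := fun w => x (val w).

Definition window_trace (W : {fset V}) (x : V -> A) : nat -> W -> A :=
  fun t => restr (iter t Phi x).

Definition posexpansive_window (W : {fset V}) : Prop :=
  set_inj X (@window_trace W).

Definition posexpansive : Prop := exists W : {fset V}, posexpansive_window W.

End Posexpansive.

Definition A : choiceType := ('Z_2 * 'Z_2)%type.

(* A vertex is its index: n stands for a box if n is in the range of m and for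
   a circle otherwise. *)
Definition V : choiceType := nat.

Definition m (k : nat) : nat := \sum_(0 <= i < k.+1) 2 * i.

Definition V_box : set V := range m.
Definition V_circ : set V := ~` V_box.

Definition X : set (V -> A) :=
  [set x | forall n, V_circ n -> (x n).2 = 0%R].

(* Since k <= m k, the rank of a box n = m k is found among k <= n. *)
Definition Phi (x : V -> A) : V -> A := fun n : nat =>
  if [pick k : 'I_n.+1 | m k == n] is Some k
  then ((x n.+1).1, (x (m k.+1)).1 + (x (m k.+1)).2)%R
  else ((x n.+1).1, 0%R).

Lemma mE k : m k = k * k.+1.
Proof.
rewrite /m; elim: k => [|k IHk]; first by rewrite big_nat1.
by rewrite big_nat_recr //= IHk -mulnDl addn2 mulnC.
Qed.

Lemma m_inj : injective m.
Proof.
have lt_m i j : i < j -> m i < m j by move=> ij; rewrite !mE ltn_mul.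
by move=> i j eq_m; case: (ltngtP i j) => // /lt_m; rewrite eq_m ltnn.
Qed.

Lemma Phi_box x k :
  Phi x (m k) = ((x (m k).+1).1, (x (m k.+1)).1 + (x (m k.+1)).2)%R.
Proof.
rewrite /Phi; case: pickP => [j /eqP/m_inj -> //|no_k].
have km : k < (m k).+1 by rewrite ltnS mE leq_pmulr.
by have := no_k (Ordinal km); rewrite eqxx.
Qed.

Lemma Phi_circ x n : V_circ n -> Phi x n = ((x n.+1).1, 0%R).
Proof.
rewrite /Phi => Mn; case: pickP => [k /eqP kn|//].
by case: Mn; exists k.
Qed.

Lemma Phi_X : Phi @` X `<=` X.
Proof. by move=> _ [x _ <-] n Mn; rewrite Phi_circ. Qed.

Lemma Phi_continuous :
  continuous (Phi : {ptws V -> discrete_topology A} ->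
                    {ptws V -> discrete_topology A}).
Proof.
move=> x; have x_filter : Filter (nbhs x) by exact: nbhs_filter.
have coord v : \forall y \near x, y v = x v.
  exact: (@proj_continuous V (fun=> discrete_topology A) v x _
            (discrete_set1 _)).
apply/cvg_sup => n U [_ [[W _ <-] Wx] WU].
have eq_Phi : \forall y \near x, Phi y n = Phi x n.
  have := coord n.+1; rewrite /Phi; case: pickP => [k _|_] coord1.
    by apply: filterS2 coord1 (coord (m k.+1)) => y -> ->.
  by apply: filterS coord1 => y ->.
by apply: filterS eq_Phi => y yx; apply: WU; rewrite /= yx.
Qed.

Lemma V_box0 : V_box 0.
Proof. by exists 0; rewrite ?mE. Qed.

(* Main.v *)
(** After t steps the a-state of vertex n is the initial a-state of n + t, so
    the trace at vertex 0 determines every a_n.  The recursion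
    b'_{m_k} = a_{m_{k+1}} + b_{m_{k+1}} then transports knowledge of the
    b-state for all times from m_k to m_{k+1}. *)
Require Import Defs.
From mathcomp Require Import all_boot finmap.
From mathcomp Require Import all_algebra boolp classical_sets.

Lemma Phi_fst (x : V -> A) (n : nat) : (Phi x n).1 = (x n.+1).1.
Proof. by rewrite /Phi; case: pickP. Qed.

Lemma iter_Phi_fst (t : nat) (x : V -> A) (n : nat) :
  (iter t Phi x n).1 = (x (n + t)).1.
Proof.
elim: t n => [|t IHt] n; first by rewrite addn0.
by rewrite iterS Phi_fst IHt addSnnS.
Qed.

Lemma iterS_Phi_box_snd (t : nat) (x : V -> A) (k : nat) :
  (iter t.+1 Phi x (m k)).2 =
    ((x (m k.+1 + t)).1 + (iter t Phi x (m k.+1)).2)%R.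
Proof. by rewrite iterS Phi_box /= iter_Phi_fst. Qed.

Local Open Scope fset_scope.

Lemma posexpansive_window_box0 : posexpansive_window X Phi [fset (0%N : V)].
Proof.
move=> x y /set_mem Xx /set_mem Xy eq_trace.
have eq0 t : iter t Phi x 0 = iter t Phi y 0.
  have := congr1 (fun f => f t [` fset11 (0%N : V)]) eq_trace.
  by rewrite /window_trace /restr.
have eq_fst n : (x n).1 = (y n).1.
  by have := congr1 fst (eq0 n); rewrite !iter_Phi_fst.
(* All times [t] are needed at once: the b-state of [m k.+1] at time [t] is read off from [m k] at
   time [t.+1]. The base case is the trace itself, as [m 0] is [0]. *)
have eq_snd k t : (iter t Phi x (m k)).2 = (iter t Phi y (m k)).2.
  elim: k t => [|k IHk] t; first by rewrite mE eq0.
  (* The a-terms agree by [eq_fst] and cancel, leaving the b-states of [m k.+1]. *)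
  have := IHk t.+1; rewrite !iterS_Phi_box_snd eq_fst.
  exact: GRing.addrI.
apply/funext => n; rewrite [x n]surjective_pairing [y n]surjective_pairing.
rewrite eq_fst; congr pair.
have [[k _ <-]|circ_n] := pselect (V_box n); first exact: (eq_snd k 0).
(* At a circle, membership in [X] makes both b-states zero. *)
by rewrite Xx ?Xy.
Qed.

Theorem lemma4p1 :
  posexpansive X Phi /\ posexpansive_window X Phi [fset (0%N : V)].
Proof.
split; last exact: posexpansive_window_box0.
by exists [fset (0%N : V)]; exact: posexpansive_window_box0.
Qed.
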